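(* Let $p\geqslant 7$ be a prime and let $k$ be an integer with $1\leqslant k\leqslant\lfloor (p-1)/2\rfloor$ and $k^2\not\equiv\pm1\pmod p$. Let $\Lambda=\mathrm{GP}(p,k)$, let $\Psi=(\Lambda,\sigma)$ be a signed graph on $\Lambda$, and put $$E_1=\{(0,j)(0,j+1)\mid 0\leqslant j\leqslant p-1\},\quad E_2=\{(1,j)(1,j+k)\mid 0\leqslant j\leqslant p-1\},\quad E_3=\{(0,j)(1,j)\mid 0\leqslant j\leqslant p-1\}.$$ If $|\sigma(E_1)|=|\sigma(E_2)|=|\sigma(E_3)|=1$, then $\mathrm{Aut}(\Psi)=A(p,k)$; otherwise $\mathrm{Aut}(\Psi)$ contains at most two elements.
   Context: The generalized Petersen graph $\mathrm{GP}(n,k)$, for $n\geqslant 3$ and $1\leqslant k\leqslant\lfloor (n-1)/2\rfloor$, has vertex set $\mathbb{Z}_2\times\mathbb{Z}_n$ and edge set $\{(0,j)(0,j+1),\ (0,j)(1,j),\ (1,j)(1,j+k)\mid j=0,1,\ldots,n-1\}$, where sums in the second coordinate are taken modulo $n$. $A(n,k)=\mathrm{Aut}(\mathrm{GP}(n,k))$ denotes its graph automorphism group. A signed graph on a graph $\Gamma=(V_\Gamma,E_\Gamma)$ is a pair $(\Gamma,\sigma)$ with $\sigma:E_\Gamma\to\{+1,-1\}$. For a nonempty $F\subseteq E_\Gamma$, $\sigma(F)=\{\sigma(e)\mid e\in F\}\subseteq\{+1,-1\}$. An automorphism of a signed graph $(\Gamma,\sigma)$ is an automorphism of $\Gamma$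 that preserves edge signs; $\mathrm{Aut}(\Psi)$ denotes the group of all automorphisms of the signed graph $\Psi$. *)

(* Defs.v *)
From HB Require Import structures.
From mathcomp Require Import all_boot all_order all_algebra all_fingroup.

Set Implicit Arguments.
Unset Strict Implicit.
Unset Printing Implicit Defensive.

Import GRing.Theory.

Local Open Scope ring_scope.

(* A graph on the finite vertex type V is given by its set of edges, an edge
   being the set of its two end-vertices; [simple_graph] excludes loops. *)
Definition simple_graph (V : finType) (E : {set {set V}}) : Prop :=
  forall e : {set V}, e \in E -> #|e| = 2%N.

Definition edge (V : finType) (E : {set {set V}}) := {e : {set V} | e \in E}.

Definition graph_aut (V : finType) (E : {set {set V}}) : {set {perm V}} :=
  [set f : {perm V} | [set f @: e | e : {set V} in E] == E].

Definition sign := seq_sub [:: 1; -1 : int].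

Definition signature (V : finType) (E : {set {set V}}) := edge E -> sign.

Definition signs_on (V : finType) (E : {set {set V}}) (sigma : signature E)
    (F : {set {set V}}) : {set sign} :=
  [set sigma e | e : edge E & val e \in F].

Definition signed_aut (V : finType) (E : {set {set V}}) (sigma : signature E) :
    {set {perm V}} :=
  [set f in graph_aut E |
    [forall e : edge E, forall e' : edge E,
      (val e' == f @: val e) ==> (sigma e' == sigma e)]].

Lemma graph_aut_edge (V : finType) (E : {set {set V}}) (f : {perm V}) e :
  f \in graph_aut E -> e \in E -> f @: e \in E.
Proof. by rewrite inE => /eqP fE eE; rewrite -fE imset_f. Qed.

Lemma imset_permM (V : finType) (f g : {perm V}) (A : {set V}) :
  (f * g)%g @: A = g @: (f @: A).
Proof. by rewrite -imset_comp; apply: eq_imset => x; rewrite permM. Qed.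

Lemma imset_perm1 (V : finType) (A : {set V}) : (1%g : {perm V}) @: A = A.
Proof. by rewrite -[RHS]imset_id; apply: eq_imset => x; rewrite perm1. Qed.

Lemma graph_aut_group_set (V : finType) (E : {set {set V}}) :
  group_set (graph_aut E).
Proof.
apply/group_setP; split.
  rewrite inE; apply/eqP; rewrite -[RHS]imset_id; apply: eq_imset => A.
  exact: imset_perm1.
move=> f g; rewrite !inE => /eqP fE /eqP gE; apply/eqP.
rewrite -[RHS]gE -[in RHS]fE -imset_comp; apply: eq_imset => A.
exact: imset_permM.
Qed.

Canonical graph_aut_group (V : finType) (E : {set {set V}}) :=
  Group (graph_aut_group_set E).

Lemma signed_autP (V : finType) (E : {set {set V}}) (sigma : signature E)
    (f : {perm V}) :
  reflect (f \in graph_aut E /\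
           forall e e' : edge E, val e' = f @: val e -> sigma e' = sigma e)
          (f \in signed_aut sigma).
Proof.
rewrite [f \in signed_aut _]inE; apply: (iffP andP) => -[fA fs]; split=> //.
  move=> e e' e'E; apply/eqP; move/forallP/(_ e)/forallP/(_ e')/implyP: fs.
  by apply; apply/eqP.
apply/forallP => e; apply/forallP => e'; apply/implyP => /eqP e'E.
by apply/eqP/fs.
Qed.

Lemma signed_aut_group_set (V : finType) (E : {set {set V}})
    (sigma : signature E) : group_set (signed_aut sigma).
Proof.
apply/group_setP; split.
  apply/signed_autP; split=> [|e e']; first exact: group1.
  by rewrite imset_perm1 => /val_inj ->.
move=> f g /signed_autP[fA fs] /signed_autP[gA gs]; apply/signed_autP.
split=> [|e e' e'E]; first exact: groupM.
pose fe : edge E := Sub (f @: val e) (graph_aut_edge fA (valP e)).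
by rewrite -(fs e fe) //; apply: gs; rewrite e'E imset_permM.
Qed.

Canonical signed_aut_group (V : finType) (E : {set {set V}})
    (sigma : signature E) := Group (signed_aut_group_set sigma).

(* 'Z_n is the ring of integers modulo n only for n > 1; generalized Petersen
   graphs are considered for 3 <= n and 1 <= k <= (n - 1) %/ 2. *)
Definition gp_vertex (n : nat) := ('Z_2 * 'Z_n)%type.

Definition outer_edges (n : nat) : {set {set gp_vertex n}} :=
  [set [set (0, j); (0, j + 1)] | j : 'Z_n].

Definition inner_edges (n k : nat) : {set {set gp_vertex n}} :=
  [set [set (1, j); (1, j + k%:R)] | j : 'Z_n].

Definition spokes (n : nat) : {set {set gp_vertex n}} :=
  [set [set (0, j); (1, j)] | j : 'Z_n].

Definition GP (n k : nat) : {set {set gp_vertex n}} :=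
  outer_edges n :|: inner_edges n k :|: spokes n.

Lemma GP_simple (n k : nat) : (3 <= n)%N -> (1 <= k <= (n - 1) %/ 2)%N ->
  simple_graph (GP n k).
Proof.
move=> n3 /andP[k1 kn] e.
have kltn : (k < n)%N.
  apply: leq_ltn_trans kn _; apply: leq_ltn_trans (leq_div _ _) _.
  by rewrite subn1 ltn_predL (ltnW (ltnW n3)).
have kn0 : (k%:R : 'Z_n) != 0.
  apply/eqP => /(congr1 val) /=; rewrite val_Zp_nat ?(ltnW n3) //.
  by rewrite modn_small // => k0; rewrite k0 in k1.
have add_neq (j i : 'Z_n) : i != 0 -> j != j + i.
  by apply: contra => /eqP /esym jE; rewrite -(addrI j (_ : j + i = j + 0)) // addr0.
rewrite !inE => /orP[/orP[] /imsetP[j _ ->] | /imsetP[j _ ->]];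
  by rewrite cards2 xpair_eqE /= ?add_neq ?oner_eq0.
Qed.

(* Main.v *)
Require Import Defs.
From mathcomp Require Import all_boot all_order all_algebra all_fingroup.
From mathcomp Require Import zify ring.

(** Count, for every arc of GP(p, k), the closed non-backtracking walks of
    length 8 that start and end with this arc.  The count depends only on the
    kind of edge (outer, inner, spoke), and one kind always differs from the
    two others.  Indeed GP(p, k) is covered by an infinite graph on two copies
    of Z^2, where (a, b) lies over a + b k, so the count is determined by the
    pairs (a, b) with |a| + |b| <= 8 and a + b k = 0 mod p.  If p > 64 these
    pairs are proportional to each other, because their determinants are
    multiples of p that are at most 64 in absolute value; this leaves finitely
    many cases, as does p <= 64.  Hence automorphisms preserve the spokes,
    which together with k^2 <> 1, -1 forces them to be
    (s, j) |-> (s, c + e j) with e = 1 or e = -1.  Among three automorphisms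
    two share the same e, so their quotient is a nontrivial rotation, whose
    powers act transitively on each of the three classes of edges as p is
    prime. *)

Set Implicit Arguments.
Unset Strict Implicit.
Unset Printing Implicit Defensive.

Import Order.TTheory GRing.Theory Num.Theory.

Local Open Scope ring_scope.

(** * Non-backtracking walks in the infinite cover *)

(* The vertex (s, (a, b)) lies over (s, j + a + b k) for a base point j; see
   [project]. *)
Definition cover_vertex := (bool * (int * int))%type.

Definition cover_step (s : bool) : int * int := if s then (0, 1) else (1, 0).

Definition cover_nbrs (x : cover_vertex) : seq cover_vertex :=
  [:: (x.1, x.2 + cover_step x.1); (x.1, x.2 - cover_step x.1); (~~ x.1, x.2)].

(** The state of a walk is its last arc [(x, y)]: the vertex [x] is kept to forbid turning back.
    Arcs occur with multiplicity, once per walk. *)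
Fixpoint walk_ends n (x y : cover_vertex) :=
  if n is n'.+1 then
    flatten [seq walk_ends n' y z | z <- cover_nbrs y & z != x]
  else [:: (x, y)].

(* The differences between the last arc of a walk and its first one; both must
   vanish in Z_p for the walk to close up in GP(p, k). *)
Definition displacements x y : seq ((int * int) * (int * int)) :=
  [seq (e.1.2 - x.2, e.2.2 - y.2) |
    e <- walk_ends 8 x y & (e.1.1 == x.1) && (e.2.1 == y.1)].

Definition arc_displacements :=
  [seq displacements (s, 0) y | s <- [:: false; true], y <- cover_nbrs (s, 0)].

Definition closed_in (o : pred (int * int)) (d : (int * int) * (int * int)) :=
  o d.1 && o d.2.

(* The arcs occur in the order outer, outer reversed, spoke, inner, inner
   reversed, spoke, as [separating] assumes. *)
Definition octagons (o : pred (int * int)) : seq nat :=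
  [seq count (closed_in o) D | D <- arc_displacements].

Definition separating (c : seq nat) :=
  if c is [:: o1; o2; s1; i1; i2; s2] then
    [&& o1 == o2, i1 == i2, s1 == s2 &
        [|| (s1 != o1) && (s1 != i1), (i1 != o1) && (i1 != s1)
          | (o1 != s1) && (o1 != i1)]]
  else false.

(** The lattice of translations of the cover that become trivial in GP(p, k). *)
Definition relation_mod (p k : nat) (v : int * int) :=
  (p%:Z %| v.1 + v.2 * k%:Z)%Z.

Definition relation_of (w v : int * int) := v.1 * w.2 == v.2 * w.1.

Definition short (v : int * int) := (`|v.1| + `|v.2| <= 8)%N.

(** * Separating the kinds of edges by their counts *)

Definition coords : seq int := [seq i%:Z - 8 | i <- iota 0 17].

(** Rim steps move by a unit vector and spokes keep the coordinates, so eight steps move a vertex by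
    at most 8. *)
Lemma displacements_short :
  all (all (fun d => short d.1 && short d.2)) arc_displacements.
Proof. by vm_compute. Qed.

Lemma separating_small : all (fun p => prime p ==>
  all (fun k => (k%:Z ^+ 2 != 1 %[mod p%:Z])%Z &&
                (k%:Z ^+ 2 != -1 %[mod p%:Z])%Z ==>
     separating (octagons (relation_mod p k)))
  (iota 1 (p %/ 2))) (iota 7 58).
Proof. by vm_compute. Qed.

(** The case without nonzero short relations: only the walks that close up in the cover itself
    count. *)
Lemma separating_trivial : separating (octagons (pred1 0)).
Proof. by vm_compute. Qed.

(** The case where the short relations fill a line. Lines with a zero coordinate or of slope 1 or -1
    are left out: they would force p to divide a small nonzero number or k, or k^2 = 1 mod p. *)
Lemma separating_lines : all (fun a => all (fun b =>
    [&& a != 0, b != 0 & `|a|%N != `|b|%N] && short (a, b) ==>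
    separating (octagons (relation_of (a, b)))) coords) coords.
Proof. by vm_compute. Qed.

Lemma mem_coords (a : int) : (`|a| <= 8)%N -> a \in coords.
Proof.
move=> a8; apply/mapP; exists (absz (a + 8)); last lia.
by rewrite mem_iota; lia.
Qed.

Lemma eq_octagons o o' : {in short, o =1 o'} -> octagons o = octagons o'.
Proof.
move=> oo'; apply/eq_in_map => D /(allP displacements_short) /allP Ds.
by apply: eq_in_count => d /Ds /andP[d1 d2]; rewrite /closed_in !oo'.
Qed.

(** Both products occur in the expansion of (|v.1| + |v.2|) (|w.1| + |w.2|), which is at most 8 *
    8. *)
Lemma short_det v w : short v -> short w ->
  (`|(v.1 * w.2 - v.2 * w.1)%R| <= 64)%N.
Proof.
rewrite /short => vs ws.
have: (`|(v.1 * w.2 - v.2 * w.1)%R| <= `|v.1| * `|w.2| + `|v.2| * `|w.1|)%N.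
  by rewrite -!abszM; lia.
move/leq_trans; apply; nia.
Qed.

Lemma relation_mod_det p k v w : relation_mod p k v -> relation_mod p k w ->
  (p%:Z %| v.1 * w.2 - v.2 * w.1)%Z.
Proof.
rewrite /relation_mod => vP wP.
have -> : v.1 * w.2 - v.2 * w.1 =
  (v.1 + v.2 * k%:Z) * w.2 - v.2 * (w.1 + w.2 * k%:Z) by ring.
by apply: rpredB; [apply: dvdz_mulr | apply: dvdz_mull].
Qed.

Lemma small_dvdz (p : nat) (a : int) : (`|a| < p)%N -> (p%:Z %| a)%Z -> a = 0.
Proof.
move=> ap; rewrite dvdzE /= => pa; apply/eqP; rewrite -absz_eq0.
by apply: contraLR ap; rewrite -lt0n -leqNgt => /dvdn_leq; apply.
Qed.

Lemma Euclid_dvdz (p : nat) (a b : int) : prime p ->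
  (p%:Z %| a * b)%Z = (p%:Z %| a)%Z || (p%:Z %| b)%Z.
Proof. by move=> p_pr; rewrite !dvdzE abszM Euclid_dvdM. Qed.

(* Otherwise conversion checks may enumerate the walks. *)
Opaque octagons.

Lemma octagons_separating p k : prime p -> (7 <= p)%N ->
    (0 < k <= (p - 1) %/ 2)%N ->
    (k%:Z ^+ 2 != 1 %[mod p%:Z])%Z -> (k%:Z ^+ 2 != -1 %[mod p%:Z])%Z ->
  separating (octagons (relation_mod p k)).
Proof.
move=> p_pr p7 /andP[k0 kp] k1 kN1.
have [p64|p64] := leqP p 64.
  have /allP/(_ p) := separating_small.
  rewrite mem_iota p7 ltnS p64 p_pr => /(_ isT)/allP/(_ k).
  rewrite mem_iota k0 k1 kN1 => /(_ _)/implyP; apply=> //; lia.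
have [/hasP[a _ /hasP[b _ /and3P[abs ab0 abP]]]|noab] := boolP (has (fun a =>
  has (fun b => [&& short (a, b), (a, b) != 0 & relation_mod p k (a, b)])
  coords) coords); last first.
  rewrite (_ : octagons _ = octagons (pred1 0)).
    exact: separating_trivial.
  apply: eq_octagons => v; rewrite unfold_in => vs.
  apply/idP/eqP => [vP|->]; last first.
    by rewrite /relation_mod mul0r addr0 dvdz0.
  apply/eqP; apply: contraNT noab => v0.
  apply/hasP; exists v.1; first exact/mem_coords/(leq_trans (leq_addr _ _) vs).
  apply/hasP; exists v.2; first exact/mem_coords/(leq_trans (leq_addl _ _) vs).
  by apply/and3P; rewrite -surjective_pairing.
have p8 : (8 < p)%N by apply: leq_ltn_trans p64.
have pk : ~~ (p%:Z %| k%:Z)%Z.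
  rewrite dvdzE /= gtnNdvd //; apply: leq_ltn_trans kp _.
  by rewrite (leq_ltn_trans (leq_div _ _)) // subn1 ltn_predL prime_gt0.
have as8 : (`|a| <= 8)%N := leq_trans (leq_addr _ _) abs.
have bs8 : (`|b| <= 8)%N := leq_trans (leq_addl _ _) abs.
have b0 : b != 0.
  apply/eqP => b0; move: abP ab0; rewrite b0 /relation_mod mul0r addr0 /=.
  by move/small_dvdz->; rewrite ?(leq_ltn_trans as8).
have a0 : a != 0.
  apply/eqP => a0; move: abP; rewrite a0 /relation_mod add0r /= Euclid_dvdz //.
  rewrite (negPf pk) orbF => /small_dvdz bE.
  by rewrite bE ?eqxx // (leq_ltn_trans bs8) in b0.
have pb : ~~ (p%:Z %| b)%Z.
  by apply: contra b0 => /small_dvdz -> //; exact: leq_ltn_trans bs8 p8.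
have ab : `|a|%N != `|b|%N.
  apply: contra k1 => /eqP ab; rewrite eqz_mod_dvd.
  have aab : a * a = b * b by rewrite -!expr2 -[a ^+ 2]real_normK ?num_real //
    -[b ^+ 2]real_normK ?num_real // -!abszE ab.
  have : (p%:Z %| b * b * (k%:Z ^+ 2 - 1))%Z.
    have -> : b * b * (k%:Z ^+ 2 - 1) = (a + b * k%:Z) * (b * k%:Z - a).
      by rewrite mulrBr mulr1 -{2}aab; ring.
    exact: dvdz_mulr.
  by rewrite !Euclid_dvdz // (negPf pb).
rewrite (_ : octagons _ = octagons (relation_of (a, b))).
  have /allP/(_ a (mem_coords as8)) := separating_lines.
  move=> /allP/(_ b (mem_coords bs8)).
  by rewrite a0 b0 ab abs => /implyP; apply.
(* A short relation has determinant 0 with [(a, b)], being a multiple of p below p in absolute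
   value. Conversely, a pair on the line is a relation after multiplication by [b], which is prime
   to p. *)
apply: eq_octagons => v; rewrite unfold_in => vs; apply/idP/eqP => /= [vP|vE].
  apply/eqP; rewrite -subr_eq0; apply/eqP; apply: (@small_dvdz p).
    exact: leq_ltn_trans (short_det vs abs) p64.
  exact: relation_mod_det vP abP.
have : (p%:Z %| (v.1 + v.2 * k%:Z) * b)%Z.
  have -> : (v.1 + v.2 * k%:Z) * b = v.2 * (a + b * k%:Z).
    by rewrite mulrDl vE; ring.
  exact: dvdz_mull.
by rewrite Euclid_dvdz // (negPf pb) orbF.
Qed.

(** * Closed walks in GP(p, k) and their lifts *)

Lemma set2_eq (T : finType) (a b c d : T) : [set a; b] = [set c; d] ->
  a = c /\ b = d \/ a = d /\ b = c.
Proof.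
move=> E.
have: a \in [set c; d] by rewrite -E set21.
have: b \in [set c; d] by rewrite -E set22.
have: c \in [set a; b] by rewrite E set21.
have: d \in [set a; b] by rewrite E set22.
rewrite !in_set2.
by do 4![case/orP=> /eqP ?]; subst; auto.
Qed.

Lemma imset_set2 (T T' : finType) (f : T -> T') a b :
  f @: [set a; b] = [set f a; f b].
Proof. by rewrite imsetU !imset_set1. Qed.

Lemma map_uniq_inj_in (T T' : eqType) (f : T -> T') s :
  uniq [seq f x | x <- s] -> {in s &, injective f}.
Proof.
elim: s => // z s IHs /= /andP[zs us] x y; rewrite !inE.
case/predU1P=> [->|xs] /predU1P[->|ys] // fE.
- by rewrite fE map_f in zs.
- by rewrite -fE map_f in zs.
- exact: IHs.
Qed.

Section ClosedWalks.
Variables (V : finType) (e : rel V).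

Fixpoint closed_walks (u v : V) n (x y : V) : nat :=
  if n is n'.+1 then (\sum_(z | e y z && (z != x)) closed_walks u v n' y z)%N
  else (x == u) && (y == v).

Lemma closed_walks_perm (f : {perm V}) :
  (forall x y, e (f x) (f y) = e x y) ->
  forall u v n x y,
  closed_walks (f u) (f v) n (f x) (f y) = closed_walks u v n x y.
Proof.
move=> fe u v; elim=> [|n IHn] x y /=; first by rewrite !(inj_eq perm_inj).
rewrite (reindex_inj (@perm_inj _ f)) /=.
by apply: eq_big => z => [|_]; rewrite ?fe ?(inj_eq perm_inj) ?IHn.
Qed.
End ClosedWalks.

Lemma Z2_cases (s : 'Z_2) : s = 0 \/ s = 1.
Proof. by case: s => [[|[|//]] i]; [left|right]; apply: val_inj. Qed.

Lemma mem_cover_nbrs x y : x \in cover_nbrs y -> y \in cover_nbrs x.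
Proof.
case: y => s v; rewrite !inE => /or3P[]/eqP->; rewrite !xpair_eqE /= ?eqxx /=.
- by rewrite addrK eqxx orbT.
- by rewrite subrK eqxx.
- by rewrite negbK !eqxx !orbT.
Qed.

Section Petersen.
Variables p k : nat.
Hypotheses (p_pr : prime p) (p_ge7 : (7 <= p)%N).
Hypotheses (k_gt0 : (1 <= k)%N) (k_le : (k <= (p - 1) %/ 2)%N).

Notation vertex := (gp_vertex p).

Lemma intr_Zp_eq0 (a : int) : (a%:~R == 0 :> 'Z_p) = (p%:Z %| a)%Z.
Proof.
by rewrite (@dvdz_pcharf 'Z_p p) // !inE p_pr pchar_Zp // prime_gt1.
Qed.

Definition gap (s : 'Z_2) : 'Z_p := if s == 0 then 1 else k%:R.

Lemma gap0 : gap 0 = 1. Proof. by []. Qed.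

Lemma gap1 : gap 1 = k%:R. Proof. by []. Qed.

Definition spoke_mate (x : vertex) : vertex := (x.1 + 1, x.2).

Definition gp_nbrs (x : vertex) : seq vertex :=
  [:: (x.1, x.2 + gap x.1); (x.1, x.2 - gap x.1); spoke_mate x].

Lemma spoke_mateK : involutive spoke_mate.
Proof.
case=> s j; rewrite /spoke_mate /=.
by case: (Z2_cases s) => ->; congr pair; apply: val_inj.
Qed.

Lemma spoke_mate_side x : (spoke_mate x).1 == x.1 = false.
Proof. by case: x => s j; case: (Z2_cases s) => ->. Qed.

Lemma GP_edge x y : ([set x; y] \in GP p k) = (y \in gp_nbrs x).
Proof.
apply/idP/idP.
  rewrite !inE => /orP[/orP[]|] /imsetP[j _ /set2_eq[]] [-> ->];
  by rewrite /gap /spoke_mate !xpair_eqE /= ?eqxx ?addrK ?eqxx ?orbT.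
have outerE (j : 'Z_p) : [set (0, j); (0, j + 1)] \in outer_edges p.
  by apply/imsetP; exists j.
have innerE (j : 'Z_p) : [set (1, j); (1, j + k%:R)] \in inner_edges p k.
  by apply/imsetP; exists j.
have spokeE (j : 'Z_p) : [set (0, j); (1, j)] \in spokes p.
  by apply/imsetP; exists j.
case: x => s j; rewrite 2!in_setU 3!inE /gap; case: (Z2_cases s) => -> /=.
  case/or3P=> /eqP->; first by rewrite outerE.
    by rewrite setUC -[X in [set _; (_, X)]](subrK 1) outerE.
  by rewrite /spoke_mate /= add0r spokeE !orbT.
case/or3P=> /eqP->; first by rewrite innerE orbT.
  by rewrite setUC -[X in [set _; (_, X)]](subrK k%:R) innerE orbT.
rewrite /spoke_mate /= (_ : 1 + 1 = 0 :> 'Z_2); last exact: val_inj.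
by rewrite [[set (1, _); _]]setUC spokeE !orbT.
Qed.

Lemma gap_muln_neq0 n s : (0 < n <= 2)%N -> gap s *+ n != 0.
Proof.
move=> n2; rewrite /gap -[_ *+ n]mulr_natr; case: ifP => _.
  rewrite mul1r -[n%:R]/(n%:Z%:~R) intr_Zp_eq0 dvdzE /= gtnNdvd //; lia.
rewrite -natrM -[(k * n)%:R]/((k * n)%N%:Z%:~R) intr_Zp_eq0 dvdzE /=.
rewrite Euclid_dvdM // !gtnNdvd //; lia.
Qed.

Lemma gap_neqN s : gap s != - gap s.
Proof. by rewrite -addr_eq0 -mulr2n gap_muln_neq0. Qed.

Lemma gp_nbrs_uniq x : uniq (gp_nbrs x).
Proof.
rewrite /= !inE !xpair_eqE eqxx (inj_eq (addrI _)) (negPf (gap_neqN _)).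
by rewrite ![_ == x.1 + 1]eq_sym (spoke_mate_side x).
Qed.

Definition project (j : 'Z_p) (x : cover_vertex) : vertex :=
  (if x.1 then 1 else 0, j + x.2.1%:~R + x.2.2%:~R * k%:R).

Lemma project_eq j x y :
  (project j x == project j y) = (x.1 == y.1) && relation_mod p k (x.2 - y.2).
Proof.
rewrite xpair_eqE; congr (_ && _); first by case: x.1; case: y.1.
rewrite /relation_mod -intr_Zp_eq0 -subr_eq0.
by congr (_ == _); rewrite /= rmorphD rmorphM /= !rmorphB /=; ring.
Qed.

Lemma project_nbrs j x :
  gp_nbrs (project j x) = [seq project j y | y <- cover_nbrs x].
Proof.
case: x => [b [m n]]; rewrite /gp_nbrs /project /spoke_mate /=.
congr [:: (_, _); (_, _); (_, _)]; last by case: b; apply: val_inj.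
  by case: b; rewrite /gap /= !rmorphD /=; ring.
by case: b; rewrite /gap /= !rmorphB /=; ring.
Qed.

Definition gp_adj : rel vertex := fun x y => [set x; y] \in GP p k.

(** The covering property: the three neighbours below are distinct, so each lifts to exactly one
    neighbour of [y]. As [x] is one of these, backtracking can be tested in the cover. *)
Lemma sum_nbrs_project j x y (F : vertex -> nat) : x \in cover_nbrs y ->
  (\sum_(z | gp_adj (project j y) z && (z != project j x)) F z =
   \sum_(z <- cover_nbrs y | z != x) F (project j z))%N.
Proof.
move=> xy; under eq_bigl do rewrite /gp_adj GP_edge.
have U := gp_nbrs_uniq (project j y).
rewrite [LHS]big_mkcondr -big_uniq //= -big_mkcond.
rewrite project_nbrs big_map [LHS]big_seq_cond [RHS]big_seq_cond.
apply: eq_bigl => z; apply: andb_id2l => zy.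
rewrite project_nbrs in U; congr (~~ _).
by apply/eqP/eqP => [/(map_uniq_inj_in U)|->]; first exact.
Qed.

Lemma closed_walks_project j u v n x y : x \in cover_nbrs y ->
  closed_walks gp_adj (project j u) (project j v) n (project j x) (project j y)
  = count (fun d => (project j d.1 == project j u)
                 && (project j d.2 == project j v)) (walk_ends n x y).
Proof.
elim: n x y => [|n IHn] x y xy; first by rewrite /= addn0.
rewrite [walk_ends _ _ _]/(flatten [seq _ | z <- cover_nbrs y & z != x]).
rewrite [LHS]sum_nbrs_project // count_flatten sumnE !big_map big_filter.
rewrite [LHS]big_seq_cond [RHS]big_seq_cond.
by apply: eq_bigr => z /andP[zy _]; exact: IHn (mem_cover_nbrs zy).
Qed.

Definition octagons_through x y := closed_walks gp_adj x y 8 x y.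

Lemma octagons_through_project j x y : y \in cover_nbrs x ->
  octagons_through (project j x) (project j y) =
  count (closed_in (relation_mod p k)) (displacements x y).
Proof.
move=> /mem_cover_nbrs xy.
rewrite /octagons_through (closed_walks_project _ _ _ _ xy).
rewrite /displacements; move: (walk_ends 8 x y) => ends.
rewrite count_map count_filter; apply: eq_count => d /=.
by rewrite !project_eq andbACA andbC.
Qed.

(** [c] gives the counts on outer and inner edges, [s] the count on spokes. The disjunction says
    which kind stands out: the spokes, or the rim edges on side [t]. *)
Lemma octagon_classes :
    (k%:Z ^+ 2 != 1 %[mod p%:Z])%Z -> (k%:Z ^+ 2 != -1 %[mod p%:Z])%Z ->
  exists (c : 'Z_2 -> nat) (s : nat),
    (forall x y, y \in gp_nbrs x ->
       octagons_through x y = if y.1 == x.1 then c x.1 else s) /\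
    ((forall t, s != c t) \/ exists t, (c t != c (t + 1)) && (c t != s)).
Proof.
move=> k1 kN1; have := octagons_separating p_pr p_ge7 _ k1 kN1.
rewrite k_gt0 => /(_ k_le).
set o := relation_mod p k.
pose N s i := count (closed_in o)
  (displacements (s, 0) (nth (s, 0) (cover_nbrs (s, 0)) i)).
have -> : octagons o = [:: N false 0%N; N false 1%N; N false 2%N;
                           N true 0%N; N true 1%N; N true 2%N] by [].
case/and4P=> /eqP o12 /eqP i12 /eqP s12 sep.
exists (fun s => if s == 0 then N false 0%N else N true 0%N), (N false 2%N).
split=> [x y|]; last first.
  case/or3P: sep => /andP[h1 h2]; [left=> t; by case: ifP | right | right].
    by exists 1; rewrite h1.
  by exists 0; rewrite h2 h1.
(* With [x.2] as base point, [x] lifts to an origin, where the tabulated walks start. *)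
have [b ->] : exists b, x = project x.2 (b, 0).
  exists (x.1 != 0); case: x => s j; rewrite /project /= mul0r !addr0.
  by case: (Z2_cases s) => ->.
rewrite project_nbrs => /mapP[y' y'x ->]; rewrite octagons_through_project //.
have -> : ((project x.2 y').1 == (project x.2 (b, 0)).1) = (y'.1 == b).
  by rewrite /=; case: y'.1; case: (b).
by move: y'x; rewrite !inE => /or3P[] /eqP->; case: b.
Qed.

Lemma GP_nbrs x y : y \in gp_nbrs x ->
  y = spoke_mate x \/
  exists2 e : 'Z_p, e = 1 \/ e = -1 & y = (x.1, x.2 + e * gap x.1).
Proof.
rewrite !inE => /or3P[]/eqP->; [right|right|by left].
  by exists 1; [left | rewrite mul1r].
by exists (-1); [right | rewrite mulN1r].
Qed.

(** * Automorphisms are rotations and reflections *)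

Section Automorphism.
Hypotheses (k2_neq1 : (k%:Z ^+ 2 != 1 %[mod p%:Z])%Z)
           (k2_neqN1 : (k%:Z ^+ 2 != -1 %[mod p%:Z])%Z).
Variable f : {perm vertex}.
Hypothesis fA : f \in graph_aut (GP p k).

Lemma graph_aut_adj x y : gp_adj (f x) (f y) = gp_adj x y.
Proof.
rewrite /gp_adj -imset_set2; apply/idP/idP; last exact: graph_aut_edge.
move/(graph_aut_edge (groupVr fA)); rewrite -imset_permM mulgV.
by rewrite imset_perm1.
Qed.

Lemma graph_aut_nbrs x y : (f y \in gp_nbrs (f x)) = (y \in gp_nbrs x).
Proof. by rewrite -!GP_edge; apply: graph_aut_adj. Qed.

Lemma mem_mate x : spoke_mate x \in gp_nbrs x.
Proof. by rewrite !inE eqxx !orbT. Qed.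

Lemma nbr_off_side x y : y \in gp_nbrs x -> y.1 != x.1 -> y = spoke_mate x.
Proof. by case/GP_nbrs => // [[e _ ->]] /eqP. Qed.

(** Automorphisms preserve the count of an arc. If [s] differs from the rim count at [f a], the
    spoke at [a] must go to a spoke. If side [t] stands out, rim edges there go to rim edges of the
    same count, so this applies to all [a] on side [t]; every spoke has an end there. *)
Lemma graph_aut_mate x : f (spoke_mate x) = spoke_mate (f x).
Proof.
have [c [s [cE sep]]] := octagon_classes k2_neq1 k2_neqN1.
have fE a b : b \in gp_nbrs a ->
    (if (f b).1 == (f a).1 then c (f a).1 else s) =
    (if b.1 == a.1 then c a.1 else s).
  move=> ab; rewrite -!cE ?graph_aut_nbrs //.
  exact: closed_walks_perm graph_aut_adj _ _ _ _ _.
have mE a : s != c (f a).1 -> f (spoke_mate a) = spoke_mate (f a).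
  move=> sc; apply: nbr_off_side; first by rewrite graph_aut_nbrs mem_mate.
  have := fE _ _ (mem_mate a); rewrite spoke_mate_side.
  by case: eqP => // _ /eqP; rewrite eq_sym (negPf sc).
case: sep => [sc|[t /andP[ct cts]]]; first exact: mE.
have tE a : a.1 = t -> f (spoke_mate a) = spoke_mate (f a).
  move=> at_; apply: mE; rewrite eq_sym.
  have := fE a (a.1, a.2 + gap a.1); rewrite !inE !eqxx => /(_ isT) /=.
  rewrite at_; case: eqP => _ E; last by rewrite -E eqxx in cts.
  by rewrite E.
have [xt|xt] := eqVneq x.1 t; first exact: tE.
have : (spoke_mate x).1 = t.
  rewrite /=; case: (Z2_cases x.1) xt => ->; case: (Z2_cases t) => -> // _;
    exact: val_inj.
by move/tE; rewrite spoke_mateK => ->; rewrite spoke_mateK.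
Qed.

Lemma graph_aut_rim s j : exists2 e : 'Z_p, e = 1 \/ e = -1 &
  f (s, j + gap s) = ((f (s, j)).1, (f (s, j)).2 + e * gap (f (s, j)).1).
Proof.
have : (s, j + gap s) \in gp_nbrs (s, j) by rewrite !inE eqxx.
rewrite -graph_aut_nbrs => /GP_nbrs[] //; rewrite -graph_aut_mate.
move/perm_inj/(congr1 fst)/eqP; rewrite eq_sym.
by have /= -> := spoke_mate_side (s, j).
Qed.

Lemma graph_aut_outer : exists2 e : 'Z_p, e = 1 \/ e = -1 & forall j,
  f (0, j) = ((f (0, 0)).1, (f (0, 0)).2 + j * (e * gap (f (0, 0)).1)).
Proof.
have [e eE e0] := graph_aut_rim 0 0; rewrite add0r in e0.
exists e => // j; set d := e * _; rewrite -[j]natr_Zp.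
(* Two consecutive vertices are carried along, since a change of direction is refuted by comparison
   with the vertex two steps back. *)
suff rimE : forall n : nat,
  f (0, n%:R) = ((f (0, 0)).1, (f (0, 0)).2 + n%:R * d) /\
  f (0, n.+1%:R) = ((f (0, 0)).1, (f (0, 0)).2 + n.+1%:R * d).
    by have [] := rimE j.
elim=> [|n [IH1 IH2]].
  by rewrite mul0r addr0 mul1r e0 -surjective_pairing.
split=> //; have [e' e'E] := graph_aut_rim 0 n.+1%:R.
rewrite gap0 natr1 IH2 /= => f2.
suff e'e : e' = e by rewrite f2 e'e -[n.+2%:R]natr1 mulrDl mul1r addrA.
apply/eqP; case: eqP => // e'Ne; have {}e'E : e' = - e.
  by case: eE e'E e'Ne => -> [] ->; rewrite ?opprK.
(* Turning back would give n and n + 2 the same image, whereas 2 is nonzero mod p. *)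
have /perm_inj[n2n] : f (0, n.+2%:R) = f (0, n%:R).
  by rewrite f2 IH1 e'E -natr1 /d; congr pair; ring.
have /eqP[] := @gap_muln_neq0 2 0 isT.
by rewrite gap0 mulr2n -[1 + 1](addKr n%:R) [n%:R + _]addrA !natr1 n2n addNr.
Qed.

Lemma sqr_neq_sign (e : 'Z_p) : e = 1 \/ e = -1 -> (k%:R : 'Z_p) ^+ 2 != e.
Proof.
have kX (a : int) :
    ((k%:R : 'Z_p) ^+ 2 == a%:~R) = (k%:Z ^+ 2 == a %[mod p%:Z])%Z.
  by rewrite eqz_mod_dvd -intr_Zp_eq0 rmorphB rmorphXn /= subr_eq0.
by case=> ->; [rewrite -[1]/(1%:~R) kX | rewrite -[-1]/((-1)%:~R) kX].
Qed.

Lemma graph_aut_dihedral : exists2 e : 'Z_p, e = 1 \/ e = -1 &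
  forall x, f x = (x.1, (f (0, 0)).2 + e * x.2).
Proof.
have f1 j : f (1, j) = spoke_mate (f (0, j)).
  by rewrite -graph_aut_mate /spoke_mate /= add0r.
have := graph_aut_outer; case: (f (0, 0)) => t c /= [e eE f0].
have [t0|t1] := Z2_cases t.
  rewrite t0 gap0 mulr1 in f0; exists e => // -[s j].
  by case: (Z2_cases s) => ->; rewrite ?f1 f0 /spoke_mate /= ?add0r mulrC.
(* Suppose [f] swaps the rims. Outer steps become steps of e k, so the inner edge from 0 to k, that
   is k outer steps between mates, becomes a step of e k^2 on the outer rim. It must be 1 or -1,
   hence so is k^2. *)
rewrite t1 gap1 in f0.
have [e' e'E] := graph_aut_rim 1 0.
rewrite !f1 !f0 add0r gap1 /spoke_mate /=.
rewrite (_ : 1 + 1 = 0 :> 'Z_2); last exact: val_inj.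
rewrite gap0 mul0r addr0 mulr1 => /(congr1 snd) /= /addrI kE.
have /sqr_neq_sign/eqP[] : e * e' = 1 \/ e * e' = -1.
  by case: eE e'E => -> [] ->; rewrite ?mul1r ?mulN1r ?opprK; auto.
rewrite -kE; case: eE => ->; ring.
Qed.
End Automorphism.
End Petersen.

(** * Edge signs and the order of the signed automorphism group *)

Section SignedPetersen.
Variables p k : nat.

Notation vertex := (gp_vertex p).

Definition edge_classes : seq {set {set vertex}} :=
  [:: outer_edges p; inner_edges p k; spokes p].

Lemma edge_classes_GP F e : F \in edge_classes -> e \in F -> e \in GP p k.
Proof. by rewrite !inE => /or3P[] /eqP-> ->; rewrite ?orbT. Qed.

Lemma dihedral_edge_class (f : {perm vertex}) (c e : 'Z_p) :
    e = 1 \/ e = -1 -> (forall x : vertex, f x = (x.1, c + e * x.2)) ->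
  forall F E, F \in edge_classes -> E \in F -> f @: E \in F.
Proof.
move=> eE fE F E; rewrite !inE => /or3P[]/eqP-> /imsetP[j _ ->];
  rewrite imset_set2 !fE /=; apply/imsetP.
- case: eE => ->; first by exists (c + j); rewrite // !mul1r addrA.
  (* A reflection reverses the edge, so its image starts at the image of [j + 1]. *)
  by exists (c - j - 1); rewrite // subrK setUC !mulN1r opprD addrA.
- case: eE => ->; first by exists (c + j); rewrite // !mul1r addrA.
  by exists (c - j - k%:R); rewrite // subrK setUC !mulN1r opprD addrA.
- by exists (c + e * j).
Qed.

Lemma rotation_edge_class (f : {perm vertex}) (c : 'Z_p) :
    c \is a GRing.unit -> (forall x : vertex, f x = (x.1, x.2 + c)) ->
  forall F E E', F \in edge_classes -> E \in F -> E' \in F ->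
  exists n, E' = (f ^+ n)%g @: E.
Proof.
move=> cU fE F E E'.
have fX n x : (f ^+ n)%g x = (x.1, x.2 + c *+ n).
  elim: n => [|n IHn]; first by rewrite expg0 perm1 addr0 -surjective_pairing.
  by rewrite expgSr permM IHn fE /= mulrSr addrA.
have cX (i j : 'Z_p) : exists n, j = i + c *+ n.
  exists ((j - i) / c : 'Z_p); rewrite -mulr_natr natr_Zp mulrCA divrr //.
  by rewrite mulr1 addrC subrK.
rewrite !inE => /or3P[]/eqP-> /imsetP[i _ ->] /imsetP[j _ ->];
  have [n ->] := cX i j; exists n; by rewrite imset_set2 !fX /= // addrAC.
Qed.

Variable sigma : signature (GP p k).

Lemma signs_on_card1 F (e e' : edge (GP p k)) :
  #|signs_on sigma F| = 1%N -> val e \in F -> val e' \in F ->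
  sigma e = sigma e'.
Proof.
move/eqP/cards1P=> [a Fa] eF e'F.
have: sigma e \in signs_on sigma F by rewrite imset_f // inE.
have: sigma e' \in signs_on sigma F by rewrite imset_f // inE.
by rewrite Fa !inE => /eqP-> /eqP.
Qed.

Lemma signs_on_constant F : F \in edge_classes ->
  (forall e e' : edge (GP p k), val e \in F -> val e' \in F ->
    sigma e = sigma e') -> #|signs_on sigma F| = 1%N.
Proof.
move=> FE Fc.
have [E EF] : exists E, E \in F.
  move: FE; rewrite !inE => /or3P[]/eqP->; eexists;
    by apply/imsetP; exists 0.
pose e0 : edge (GP p k) := Sub E (edge_classes_GP FE EF).
apply/eqP/cards1P; exists (sigma e0); apply/setP=> a; rewrite inE.
apply/imsetP/eqP => [[e]|->]; first by rewrite inE => eF ->; apply: Fc.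
by exists e0; rewrite ?inE.
Qed.

Hypotheses (p_pr : prime p) (p_ge7 : (7 <= p)%N).
Hypotheses (k_gt0 : (1 <= k)%N) (k_le : (k <= (p - 1) %/ 2)%N).
Hypotheses (k2_neq1 : (k%:Z ^+ 2 != 1 %[mod p%:Z])%Z)
           (k2_neqN1 : (k%:Z ^+ 2 != -1 %[mod p%:Z])%Z).

Let dihedral := graph_aut_dihedral p_pr p_ge7 k_gt0 k_le k2_neq1 k2_neqN1.

Lemma signed_aut_full :
    (forall F, F \in edge_classes -> #|signs_on sigma F| = 1%N) ->
  signed_aut sigma = graph_aut (GP p k).
Proof.
move=> F1; apply/setP=> f; apply/signed_autP/idP=> [[]//|fA]; split=> // e e'.
have [F FE eF] : exists2 F, F \in edge_classes & val e \in F.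
  have:= valP e; rewrite !inE -orbA => /or3P[] eF;
    by [exists (outer_edges p); rewrite ?inE ?eqxx ?orbT |
        exists (inner_edges p k); rewrite ?inE ?eqxx ?orbT |
        exists (spokes p); rewrite ?inE ?eqxx ?orbT].
have [c cE fE] := dihedral fA.
move=> e'E; apply: (signs_on_card1 (F1 F FE)) => //.
by rewrite e'E (dihedral_edge_class cE fE).
Qed.

Lemma Zp_unit (c : 'Z_p) : c != 0 -> c \is a GRing.unit.
Proof.
move=> c0; rewrite -[c]natr_Zp unitZpE ?prime_gt1 // prime_coprime //.
by rewrite gtnNdvd ?lt0n // -[X in (_ < X)%N]Zp_cast ?prime_gt1.
Qed.

Lemma rotation_signs (f : {perm vertex}) (c : 'Z_p) :
    f \in signed_aut sigma -> c != 0 ->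
    (forall x : vertex, f x = (x.1, x.2 + c)) ->
  forall F, F \in edge_classes -> #|signs_on sigma F| = 1%N.
Proof.
move=> fA /Zp_unit cU fE F FE; apply: signs_on_constant => // e e' eF e'F.
have [n e'E] := rotation_edge_class cU fE FE eF e'F.
by have /signed_autP[_ /(_ e e' e'E)->] := groupX n fA.
Qed.

Lemma signed_aut_gt2 : (2 < #|signed_aut sigma|)%N ->
  forall F, F \in edge_classes -> #|signs_on sigma F| = 1%N.
Proof.
(* [eps] reads the sign e off the images of two adjacent vertices; being boolean, it cannot be
   injective on three automorphisms. *)
pose eps (f : {perm vertex}) := (f (0, 1)).2 == (f (0, 0)).2 + 1.
have epsE (f : {perm vertex}) (c e : 'Z_p) : e = 1 \/ e = -1 ->
    (forall x : vertex, f x = (x.1, c + e * x.2)) ->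
    e = if eps f then 1 else -1.
  move=> eE fE; rewrite /eps !fE /= mulr0 mulr1 addr0 (inj_eq (addrI _)).
  by case: eqP => // e1; case: eE.
have [/dinjectiveP eps_inj|] := boolP (dinjectiveb eps (signed_aut sigma)).
  rewrite -(card_in_imset eps_inj) ltnNge.
  by rewrite (leq_trans (max_card _)) ?card_bool.
case/dinjectivePn=> f fS [g /andP[/= gf gS] fg] _.
have /signed_autP[/dihedral[e eE fE] _] := fS.
have /signed_autP[/dihedral[e' e'E gE] _] := gS.
have ee' : e' = e by rewrite (epsE _ _ _ eE fE) fg -(epsE _ _ _ e'E gE).
set c := (f _).2 in fE; set c' := (g _).2 in gE.
(* [f^-1] acts first: it takes c + e y to y, and [g] takes y to c' + e y. The shift c' - c is
   nonzero because [f] and [g] differ. *)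
apply: (@rotation_signs (f^-1 * g)%g (c' - c)).
- by rewrite groupM ?groupV.
- apply: contra gf; rewrite subr_eq0 => /eqP cc'; apply/eqP/permP => x.
  by rewrite gE fE cc' ee'.
- move=> x; rewrite permM; have := permKV f x; set y := (f^-1)%g x.
  by rewrite fE gE ee' => <- /=; congr pair; ring.
Qed.
End SignedPetersen.

Theorem theorem3p2 (p k : nat) (p_pr : prime p) (p_ge7 : (7 <= p)%N)
    (k_gt0 : (1 <= k)%N) (k_le : (k <= (p - 1) %/ 2)%N)
    (k2_neq1 : (k%:Z ^+ 2 != 1 %[mod p%:Z])%Z)
    (k2_neqN1 : (k%:Z ^+ 2 != -1 %[mod p%:Z])%Z)
    (sigma : signature (GP p k)) :
  if [&& #|signs_on sigma (outer_edges p)| == 1,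
         #|signs_on sigma (inner_edges p k)| == 1
       & #|signs_on sigma (spokes p)| == 1]%N
  then signed_aut sigma = graph_aut (GP p k)
  else (#|signed_aut sigma| <= 2)%N.
Proof.
case: ifPn => [/and3P[/eqP o1 /eqP i1 /eqP s1]|not1].
  by apply: signed_aut_full => // F; rewrite !inE => /or3P[]/eqP->.
apply: contraR not1; rewrite -ltnNge => /signed_aut_gt2 F1.
by rewrite !F1 // !inE eqxx ?orbT.
Qed.
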